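(* For all integers $r\ge 0$ and $p>0$, and every $x\in\mathbb{C}$ with $|x|<2$, $$\sum_{n=1}^{\infty}\binom{n+r}{n}n^{p}\left\{\zeta(n+1)-1\right\}x^{n}=\frac{1}{r!}\sum_{j=0}^{p}S(p,j)\,(r+j)!\,A(r,x,j)\,x^{j},$$ where $$A(r,x,j)=\sum_{m=0}^{r}\binom{r}{m}x^{m}\zeta(m+j+1,2-x).$$
   Context: $S(p,j)$ denotes the Stirling numbers of the second kind; $S(p,0)=0$ for $p\ge1$. The Hurwitz zeta function is $\zeta(s,a)=\sum_{k=0}^{\infty}\frac{1}{(k+a)^{s}}$ for $\mathrm{Re}\,a>0$, $\mathrm{Re}\,s>1$, and $\zeta(s)=\zeta(s,1)$ is the Riemann zeta function. The $j=0$ term of the right-hand side is taken to be $0$ because $S(p,0)=0$ (so $A(r,x,0)$, which would involve the undefined $\zeta(1,2-x)$, does not enter). $x^0=1$. *)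

(* Defs.v *)
(* C is the type of complex numbers here; the real-valued binomial coefficient
   of the standard library is Binomial.C n k. *)
From Stdlib Require Import Reals.
From Coquelicot Require Export Coquelicot.

(* S(n,k), by S(n+1,k+1) = (k+1) S(n,k+1) + S(n,k). *)
Fixpoint stirling2 (n k : nat) : nat :=
  match n, k with
  | O, O => 1
  | O, S _ => 0
  | S _, O => 0
  | S n', S k' => (k * stirling2 n' k + stirling2 n' k')%nat
  end.

(* Total: this is the sum of the series only when the series converges,
   like Coquelicot's real Series. *)
Definition CSeries (a : nat -> C) : C :=
  (Series (fun k => Re (a k)), Series (fun k => Im (a k))).

Definition Cexp (z : C) : C :=
  (exp (Re z) * cos (Im z), exp (Re z) * sin (Im z))%R.

(* Principal logarithm on the half-plane 0 < Re z only: there the principal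
   argument of z is atan (Im z / Re z). *)
Definition Cln_right (z : C) : C :=
  (ln (Cmod z), atan (Im z / Re z)%R).

(* Principal value of z^s for 0 < Re z. *)
Definition Cpower_right (z s : C) : C := Cexp (s * Cln_right z)%C.

(* Meaningful for 1 < Re s and 0 < Re a, where all bases k + a lie in the
   right half-plane and the series converges. *)
Definition hurwitz_zeta (s a : C) : C :=
  CSeries (fun k => (1 / Cpower_right (RtoC (INR k) + a) s)%C).

Definition riemann_zeta (s : C) : C := hurwitz_zeta s 1.

Definition A (r : nat) (x : C) (j : nat) : C :=
  sum_n (fun m => (RtoC (Binomial.C r m) * x ^ m
                   * hurwitz_zeta (RtoC (INR (m + j + 1))) (2 - x))%C) r.

(* Main.v *)
Require Import Defs.
From Stdlib Require Import Reals Factorial Lra Lia.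
From Coquelicot Require Import Coquelicot.

(** For [n >= 1], [riemann_zeta (n + 1) - 1] is the sum over [k >= 0] of
    [/ (k + 2)^(n + 1)], so the left-hand side is a double series with general
    term [C(n + r, n) n^p x^n / (k + 2)^(n + 1)]. Since [Cmod x < 2], this term
    is at most [(C(n + r, n) n^p rho^n) * (2 / (k + 1)^2)] with
    [rho = Cmod x / 2 < 1] ([double_series_bound]), the product of the terms of
    two convergent series, and the summations may be exchanged
    ([is_series_interchange]).

    For fixed [k] put [y = x / (k + 2)]. Writing [n^p] as the combination of
    falling factorials with Stirling coefficients ([pow_stirling2]) reduces the
    sum over [n] to the series of [C(n + r, n) falling(n, j) y^n], which is
    [(r + j)! / r! * y^j / (1 - y)^(r + j + 1)]
    ([is_series_binomial_falling_pow]): up to a shift of the index by [j] it is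
    a negative binomial series. Divided by [k + 2], this is a multiple of
    [x^j (k + 2)^r / (k + 2 - x)^(r + j + 1)]. Expanding
    [(k + 2)^r = (x + (k + 2 - x))^r] turns it into a combination of the inverse
    powers [/ (k + 2 - x)^(m + j + 1)] ([partial_fractions]), whose sums over
    [k] are the Hurwitz zeta values in [A r x j]. The term [j = 0], for which
    the sum over [k] would diverge at [m = 0], has coefficient [S(p, 0) = 0]. *)

Open Scope R_scope.

(** * Series in normed modules *)

Lemma is_series_norm_le {K : AbsRing} {V : NormedModule K}
    (a : nat -> V) (b : nat -> R) (l : V) (B : R) :
  (forall n, norm (a n) <= b n) -> is_series a l -> is_series b B ->
  norm l <= B.
Proof.
  intros Hab Ha Hb.
  assert (Hn : is_lim_seq (fun n => norm (sum_n a n)) (norm l)).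
  { exact (filterlim_comp _ _ _ _ norm _ _ _ Ha (filterlim_norm l)). }
  refine (is_lim_seq_le _ _ (Finite (norm l)) (Finite B) _ Hn Hb).
  intros n.
  eapply Rle_trans; [ apply norm_sum_n_m | apply sum_n_m_le, Hab ].
Qed.

Lemma is_series_tail {K : AbsRing} {V : NormedModule K}
    (a : nat -> V) (l : V) (N : nat) :
  is_series a l ->
  is_series (fun n => a (S N + n)%nat) (minus l (sum_n a N)).
Proof.
  intros Ha. apply is_series_incr_n; [ lia | ].
  replace (plus _ _) with l; [ exact Ha | ].
  symmetry. unfold minus. rewrite <- plus_assoc.
  etransitivity; [ apply f_equal | apply (plus_zero_r l) ].
  apply (plus_opp_l (G := NormedModule.AbelianGroup K V)).
Qed.

Lemma is_series_zero {K : AbsRing} {V : NormedModule K} :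
  is_series (fun _ => zero : V) zero.
Proof.
  apply filterlim_ext with (fun _ => zero).
  - intros n. symmetry. apply sum_n_m_const_zero.
  - apply filterlim_const.
Qed.

Lemma is_series_incr_1_zero {K : AbsRing} {V : NormedModule K}
    (a : nat -> V) (l : V) :
  a 0%nat = zero -> is_series a l -> is_series (fun n => a (S n)) l.
Proof.
  intros H0 Ha. apply is_series_incr_1. rewrite H0.
  replace (plus l zero) with l; [ exact Ha | ].
  symmetry. exact (plus_zero_r l).
Qed.

Lemma is_series_leading_zeros {K : AbsRing} {V : NormedModule K}
    (a : nat -> V) (l : V) (N : nat) :
  (forall n, (n < N)%nat -> a n = zero) ->
  is_series (fun n => a (N + n)%nat) l -> is_series a l.
Proof.
  intros H0 Hl. destruct N as [|N]; [ exact Hl | ].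
  apply is_series_decr_n with (S N); [ lia | ]. simpl Init.Nat.pred.
  replace (sum_n a N) with (zero : V).
  - replace (plus l (opp _)) with l; [ exact Hl | ].
    symmetry. exact (minus_zero_r (G := NormedModule.AbelianGroup K V) l).
  - symmetry. rewrite (sum_n_ext_loc _ (fun _ => zero)); [ | intros; apply H0; lia ].
    apply sum_n_m_const_zero.
Qed.

Lemma is_series_sum_n {K : AbsRing} {V : NormedModule K}
    (a : nat -> nat -> V) (l : nat -> V) (N : nat) :
  (forall n, (n <= N)%nat -> is_series (a n) (l n)) ->
  is_series (fun k => sum_n (fun n => a n k) N) (sum_n l N).
Proof.
  induction N as [|N IH]; intros H.
  - rewrite sum_O. apply is_series_ext with (a 0%nat).
    + intros k. now rewrite sum_O.
    + now apply H.
  - rewrite sum_Sn.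
    apply is_series_ext with (fun k => plus (sum_n (fun n => a n k) N) (a (S N) k)).
    + intros k. now rewrite sum_Sn.
    + apply is_series_plus; [ apply IH; intros n Hn | ]; apply H; lia.
Qed.

(** A product bound makes the remainder after [N] rows at most
    [(U - sum_n u N) * W], where [U] and [W] are the sums of [u] and [v]:
    the tail of [u] controls every column at once. *)
Lemma is_series_interchange {K : AbsRing} {V : NormedModule K}
    (a : nat -> nat -> V) (u v : nat -> R) (s t : nat -> V) (L : V) :
  (forall n k, norm (a n k) <= u n * v k) ->
  ex_series u -> ex_series v ->
  (forall n, is_series (a n) (s n)) ->
  (forall k, is_series (fun n => a n k) (t k)) ->
  is_series t L ->
  is_series s L.
Proof.
  intros Hauv [U HU] [W HW] Hs Ht HL.
  assert (Hb : forall N, norm (minus L (sum_n s N)) <= (U - sum_n u N) * W).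
  { intros N.
    apply (is_series_norm_le
             (fun k => minus (t k) (sum_n (fun n => a n k) N))
             (fun k => (U - sum_n u N) * v k)).
    - intros k.
      refine (is_series_norm_le (fun n => a (S N + n)%nat k)
                (fun n => u (S N + n)%nat * v k) _ _ (fun n => Hauv _ _) _ _).
      + exact (is_series_tail _ _ N (Ht k)).
      + apply (is_series_scal_r (v k) (fun n => u (S N + n)%nat)).
        exact (is_series_tail u U N HU).
    - apply (is_series_minus t); [ exact HL | ].
      apply is_series_sum_n. intros n _. apply Hs.
    - exact (is_series_scal_l (U - sum_n u N) v W HW). }
  assert (H0 : is_lim_seq (fun N => (U - sum_n u N) * W) 0).
  { replace (Finite 0) with (Rbar_mult (U - U) W) by (simpl; f_equal; ring).
    apply (is_lim_seq_scal_r (fun N => U - sum_n u N)).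
    apply (is_lim_seq_minus' (fun _ => U)); [ apply is_lim_seq_const | exact HU ]. }
  apply filterlim_locally_ball_norm. intros eps.
  apply is_lim_seq_spec in H0. destruct (H0 eps) as [N0 HN0].
  exists N0. intros N HN. specialize (HN0 N HN). rewrite Rminus_0_r in HN0.
  apply ball_norm_sym. unfold ball_norm.
  eapply Rle_lt_trans; [ apply Hb | ].
  eapply Rle_lt_trans; [ apply Rle_abs | exact HN0 ].
Qed.

(** * Complex series and integer powers *)

Lemma is_series_Re (a : nat -> C) (l : C) :
  is_series a l -> is_series (fun n => Re (a n)) (Re l).
Proof.
  intros Ha. unfold is_series.
  apply filterlim_ext with (fun n => Re (sum_n a n)).
  - induction x as [|n IH]; [ now rewrite !sum_O | ].
    now rewrite !sum_Sn, <- IH.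
  - exact (filterlim_comp _ _ _ _ _ _ _ _ Ha (continuous_fst (fst l) (snd l))).
Qed.

Lemma is_series_Im (a : nat -> C) (l : C) :
  is_series a l -> is_series (fun n => Im (a n)) (Im l).
Proof.
  intros Ha. unfold is_series.
  apply filterlim_ext with (fun n => Im (sum_n a n)).
  - induction x as [|n IH]; [ now rewrite !sum_O | ].
    now rewrite !sum_Sn, <- IH.
  - exact (filterlim_comp _ _ _ _ _ _ _ _ Ha (continuous_snd (fst l) (snd l))).
Qed.

Lemma CSeries_unique (a : nat -> C) (l : C) : is_series a l -> CSeries a = l.
Proof.
  intros Ha. unfold CSeries.
  rewrite (is_series_unique _ _ (is_series_Re a l Ha)).
  rewrite (is_series_unique _ _ (is_series_Im a l Ha)).
  now destruct l.
Qed.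

Lemma Cexp_plus (z w : C) : Cexp (z + w) = (Cexp z * Cexp w)%C.
Proof.
  destruct z as [x y], w as [u v]. unfold Cexp. simpl.
  rewrite exp_plus, cos_plus, sin_plus.
  apply injective_projections; simpl; ring.
Qed.

Lemma Cexp_INR_mult (n : nat) (z : C) : Cexp (RtoC (INR n) * z) = (Cexp z ^ n)%C.
Proof.
  induction n as [|n IH].
  - unfold Cexp. simpl. rewrite !Rmult_0_l, Rminus_0_r, Rplus_0_l.
    rewrite exp_0, cos_0, sin_0. apply injective_projections; simpl; ring.
  - rewrite S_INR, Cpow_S, <- IH, <- Cexp_plus. f_equal.
    rewrite RtoC_plus. ring.
Qed.

(** With [x = Re z > 0] and [y = Im z], the claim reduces to
    [Cmod z = x * sqrt (1 + (y / x)^2)], since [cos (atan t)] and [sin (atan t)]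
    have [sqrt (1 + t^2)] as denominator. *)
Lemma Cexp_ln_right (z : C) : 0 < Re z -> Cexp (Cln_right z) = z.
Proof.
  destruct z as [x y]. simpl. intros Hx.
  assert (Hm : Cmod (x, y) = x * sqrt (1 + (y / x)²)).
  { unfold Cmod. simpl. rewrite <- (sqrt_Rsqr x) at 3 by lra.
    rewrite <- sqrt_mult_alt by apply Rle_0_sqr. f_equal.
    unfold Rsqr. field. lra. }
  assert (Hs : 0 < sqrt (1 + (y / x)²)).
  { apply sqrt_lt_R0. pose proof (Rle_0_sqr (y / x)). lra. }
  unfold Cexp, Cln_right. simpl.
  rewrite exp_ln, cos_atan, sin_atan, Hm by (rewrite Hm; now apply Rmult_lt_0_compat).
  apply injective_projections; simpl; field; lra.
Qed.

Lemma Cpower_right_INR (z : C) (n : nat) :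
  0 < Re z -> Cpower_right z (RtoC (INR n)) = (z ^ n)%C.
Proof.
  intros Hz. unfold Cpower_right. now rewrite Cexp_INR_mult, Cexp_ln_right.
Qed.

(** * The Hurwitz zeta function at integers *)

(** Telescoping: [/ (t + 1)^2 <= / t - / (t + 1)] bounds the partial sums by
    [2]. *)
Lemma ex_series_inv_sqr : ex_series (fun k => / INR (S k) ^ 2).
Proof.
  set (u := sum_n (fun k => / INR (S k) ^ 2)).
  assert (Hpos : forall k, 0 < INR (S k)) by (intros; apply lt_0_INR; lia).
  assert (Hu : forall n, u n <= 2 - / INR (S n)).
  { intros n. unfold u. induction n as [|n IH].
    - rewrite sum_O. simpl. lra.
    - rewrite sum_Sn. change plus with Rplus.
      enough (/ INR (S (S n)) ^ 2 <= / INR (S n) - / INR (S (S n))) by lra.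
      pose proof (Hpos n). rewrite (S_INR (S n)). set (t := INR (S n)) in *.
      replace (/ t - / (t + 1)) with (/ (t * (t + 1))) by (field; lra).
      apply Rinv_le_contravar; nra. }
  destruct (ex_finite_lim_seq_incr u 2) as [l Hl].
  - intros n. unfold u. rewrite sum_Sn. change plus with Rplus.
    enough (0 < / INR (S (S n)) ^ 2) by lra.
    apply Rinv_0_lt_compat, pow_lt, Hpos.
  - intros n. eapply Rle_trans; [ apply Hu | ].
    pose proof (Rinv_0_lt_compat _ (Hpos n)). lra.
  - now exists l.
Qed.

Lemma Re_shift (k : nat) (a : C) : Re (RtoC (INR k) + a) = INR k + Re a.
Proof. now destruct a. Qed.

(** The bases satisfy [Cmod (k + a) >= k + Re a >= d * (k + 1)] with
    [d = min (1, Re a)], so that the series is dominated by that of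
    [/ (k + 1)^2]. *)
Lemma is_series_hurwitz_zeta (n : nat) (a : C) :
  (2 <= n)%nat -> 0 < Re a ->
  is_series (fun k => / (RtoC (INR k) + a) ^ n)%C (hurwitz_zeta (RtoC (INR n)) a).
Proof.
  intros Hn Ha.
  set (d := Rmin 1 (Re a)).
  assert (Hd : 0 < d) by (apply Rmin_glb_lt; lra).
  assert (Hd1 : d <= 1) by apply Rmin_l.
  assert (Hda : d <= Re a) by apply Rmin_r.
  assert (Hre : forall k, 0 < Re (RtoC (INR k) + a)).
  { intros k. rewrite Re_shift. pose proof (pos_INR k). lra. }
  assert (Hmod : forall k, d * INR (S k) <= Cmod (RtoC (INR k) + a)).
  { intros k. eapply Rle_trans; [ | apply re_le_Cmod ].
    eapply Rle_trans; [ | apply Rle_abs ].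
    rewrite Re_shift, S_INR. pose proof (pos_INR k). nra. }
  assert (Hex : ex_series (fun k => / (RtoC (INR k) + a) ^ n)%C).
  { apply (ex_series_le (V := C_CompleteNormedModule) _
             (fun k => (/ d) ^ n * / INR (S k) ^ 2)).
    - intros k.
      assert (HS : 1 <= INR (S k)) by (rewrite S_INR; pose proof (pos_INR k); lra).
      assert (H0 : (RtoC (INR k) + a)%C <> 0).
      { intros E. specialize (Hre k). rewrite E in Hre. simpl in Hre. lra. }
      change (norm ?z) with (Cmod z).
      rewrite Cmod_inv by (now apply Cpow_nz). rewrite Cmod_pow, pow_inv, <- Rinv_mult.
      apply Rinv_le_contravar.
      + apply Rmult_lt_0_compat; apply pow_lt; lra.
      + apply Rle_trans with (d ^ n * INR (S k) ^ n).
        * apply Rmult_le_compat_l; [ apply pow_le; lra | now apply Rle_pow ].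
        * rewrite <- Rpow_mult_distr. apply pow_incr. split; [ nra | apply Hmod ].
    - exact (ex_series_scal_l ((/ d) ^ n) _ ex_series_inv_sqr). }
  destruct Hex as [l Hl].
  replace (hurwitz_zeta (RtoC (INR n)) a) with l; [ exact Hl | ].
  symmetry. apply CSeries_unique.
  apply is_series_ext with (2 := Hl).
  intros k. rewrite Cpower_right_INR by apply Hre.
  unfold Cdiv. now rewrite Cmult_1_l.
Qed.

Lemma is_series_riemann_zeta_minus_1 (n : nat) :
  is_series (fun k => / RtoC (INR (k + 2)) ^ (n + 2))%C
    (riemann_zeta (RtoC (INR (n + 2))) - 1)%C.
Proof.
  pose proof (is_series_hurwitz_zeta (n + 2) 1 ltac:(lia) ltac:(simpl; lra)) as H.
  apply (is_series_tail _ _ 0) in H. rewrite sum_O in H.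
  replace (riemann_zeta (RtoC (INR (n + 2))) - 1)%C
    with (minus (hurwitz_zeta (RtoC (INR (n + 2))) 1)
            (/ (RtoC (INR 0) + 1) ^ (n + 2)))%C.
  - eapply is_series_ext; [ | exact H ]. intros k. cbv beta.
    rewrite <- RtoC_plus, <- S_INR. now replace (k + 2)%nat with (S (1 + k)) by lia.
  - change (INR 0) with 0. rewrite Cplus_0_l, Cpow_1_l.
    replace (/ 1)%C with (RtoC 1) by (now rewrite <- RtoC_inv, Rinv_1 by lra).
    reflexivity.
Qed.

(** * Negative binomial series *)

Lemma INR_fact_pos (n : nat) : 0 < INR (fact n).
Proof. apply lt_0_INR, lt_O_fact. Qed.

Lemma binomial_pos (n k : nat) : 0 < Binomial.C n k.
Proof.
  unfold Binomial.C. apply Rdiv_lt_0_compat; [ apply INR_fact_pos | ].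
  apply Rmult_lt_0_compat; apply INR_fact_pos.
Qed.

Lemma pascal_diagonal (n q : nat) :
  Binomial.C (S n + S q) (S n) = Binomial.C (n + S q) n + Binomial.C (S n + q) (S n).
Proof.
  replace (S n + q)%nat with (n + S q)%nat by lia.
  rewrite pascal by lia. reflexivity.
Qed.

(** By Pascal's rule, [(1 - rho)] times a partial sum for [q + 1] is the partial
    sum for [q] minus a nonnegative term; hence the partial sums for [q + 1],
    which increase, stay below [B / (1 - rho)], where [B] is the sum for
    [q]. *)
Lemma ex_series_binomial_Rpow (q : nat) (rho : R) :
  0 <= rho < 1 -> ex_series (fun n => Binomial.C (n + q) n * rho ^ n).
Proof.
  intros Hrho. induction q as [|q IH].
  - apply ex_series_ext with (fun n => rho ^ n).
    + intros n. rewrite Nat.add_0_r, C_n_n. symmetry. apply Rmult_1_l.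
    + apply ex_series_geom. rewrite Rabs_pos_eq; lra.
  - assert (Hpos : forall q n, 0 <= Binomial.C (n + q) n * rho ^ n).
    { intros q' n. apply Rmult_le_pos; [ apply Rlt_le, binomial_pos | apply pow_le, Hrho ]. }
    set (s := fun q N => sum_n (fun n => Binomial.C (n + q) n * rho ^ n) N).
    assert (Hsum : forall N, (1 - rho) * s (S q) N
                    = s q N - Binomial.C (N + S q) N * rho ^ S N).
    { unfold s. induction N as [|N IHN].
      - rewrite !sum_O, !C_n_0. simpl. ring.
      - rewrite !sum_Sn. change plus with Rplus.
        rewrite Rmult_plus_distr_l, IHN, pascal_diagonal. simpl. ring. }
    destruct (IH : exists B : R, is_series _ B) as [B HB].
    assert (Hle : forall N, s q N <= B).
    { intros N. apply (is_lim_seq_incr_compare _ _ HB).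
      intros m. rewrite sum_Sn. change plus with Rplus.
      specialize (Hpos q (S m)). lra. }
    destruct (ex_finite_lim_seq_incr (s (S q)) (B / (1 - rho))) as [l Hl].
    + intros N. unfold s. rewrite sum_Sn. change plus with Rplus.
      specialize (Hpos (S q) (S N)). lra.
    + intros N. apply Rmult_le_reg_l with (1 - rho); [ lra | ].
      replace ((1 - rho) * (B / (1 - rho))) with B by (field; lra).
      rewrite Hsum. specialize (Hle N). specialize (Hpos (S q) N).
      simpl. nra.
    + now exists l.
Qed.

(** Pascal's rule says that multiplying the series for [q + 1] by [1 - y] gives
    the series for [q], and that for [q = 0] is geometric. Convergence being
    known, these are equations between sums. *)
Lemma is_series_binomial_pow (q : nat) (y : C) :
  Cmod y < 1 ->
  is_series (fun n => RtoC (Binomial.C (n + q) n) * y ^ n)%C (/ (1 - y) ^ S q)%C.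
Proof.
  intros Hy.
  assert (Hy1 : (1 - y)%C <> 0).
  { intros E. apply (Cminus_eq_contra 1 y); [ | exact E ].
    intros E1. rewrite <- E1, Cmod_1 in Hy. lra. }
  (* The norms are those of the real series at Cmod y *)
  assert (Hex : forall q, ex_series (fun n => RtoC (Binomial.C (n + q) n) * y ^ n)%C).
  { intros q'.
    apply (ex_series_le (V := C_CompleteNormedModule) _
             (fun n => Binomial.C (n + q') n * Cmod y ^ n)).
    - intros n. change (norm ?z) with (Cmod z).
      rewrite Cmod_mult, Cmod_R, Cmod_pow, Rabs_pos_eq; [ lra | ].
      apply Rlt_le, binomial_pos.
    - apply ex_series_binomial_Rpow. split; [ apply Cmod_ge_0 | exact Hy ]. }
  assert (Hmul : forall q l,
    is_series (fun n => RtoC (Binomial.C (n + S q) n) * y ^ n)%C l ->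
    is_series (fun n => RtoC (Binomial.C (n + q) n) * y ^ n)%C ((1 - y) * l)%C).
  { intros q' l Hl.
    apply is_series_decr_1.
    replace (plus ((1 - y) * l)%C _)
      with (plus (plus l (opp (RtoC (Binomial.C (0 + S q') 0) * y ^ 0)%C)) (scal (opp y) l)).
    - assert (H1 := is_series_tail _ _ 0 Hl). rewrite sum_O in H1.
      apply is_series_ext with (2 := is_series_plus _ _ _ _ H1 (is_series_scal (opp y) _ _ Hl)).
      intros n. change (1 + n)%nat with (S n). rewrite pascal_diagonal, RtoC_plus.
      rewrite Cpow_S. change plus with Cplus. change scal with Cmult. change opp with Copp.
      simpl. ring.
    - rewrite !C_n_0. change plus with Cplus. change scal with Cmult. change opp with Copp.
      simpl. ring. }
  induction q as [|q IH].
  - destruct (Hex 0%nat : exists l : C, is_series _ l) as [l Hl].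
    assert (E : minus l (RtoC 1) = scal y l).
    { assert (Hl' : is_series (fun n => y ^ n)%C l).
      { apply is_series_ext with (2 := Hl). intros n.
        rewrite Nat.add_0_r, C_n_n. apply Cmult_1_l. }
      assert (H1 := is_series_tail _ _ 0 Hl'). rewrite sum_O in H1.
      exact (filterlim_locally_unique _ _ _ H1 (is_series_scal y _ _ Hl')). }
    rewrite Cpow_1_r. replace (/ (1 - y))%C with l; [ exact Hl | ].
    change (l - 1 = y * l)%C in E.
    replace l with (/ (1 - y) * (l - y * l))%C by (field; exact Hy1).
    rewrite <- E. field. exact Hy1.
  - destruct (Hex (S q) : exists l : C, is_series _ l) as [l Hl].
    replace (/ (1 - y) ^ S (S q))%C with l; [ exact Hl | ].
    assert (E : ((1 - y) * l = / (1 - y) ^ S q)%C)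
      by exact (filterlim_locally_unique _ _ _ (Hmul _ _ Hl) IH).
    rewrite Cpow_S.
    assert (((1 - y) ^ S q)%C <> 0) by now apply Cpow_nz.
    replace l with (/ (1 - y) * ((1 - y) * l))%C by (field; exact Hy1).
    rewrite E. field. now split.
Qed.

(** * Stirling numbers and falling factorials *)

(** Over the reals, so that [pow_stirling2] is a polynomial identity, free of
    truncated subtraction. *)
Fixpoint falling (x : R) (j : nat) : R :=
  match j with
  | O => 1
  | S j' => falling x j' * (x - INR j')
  end.

Lemma stirling2_gt (n k : nat) : (n < k)%nat -> stirling2 n k = 0%nat.
Proof.
  revert k. induction n as [|n IH]; intros [|k] H; try lia; [ reflexivity | ].
  simpl. rewrite !IH by lia. lia.
Qed.

(** The recurrence of the Stirling numbers mirrors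
    [x * falling x j = falling x (S j) + j * falling x j]. The shift of [j] by one
    leaves a boundary term in the partial sums, which vanishes at [N = p + 1]
    since [stirling2 p (p + 1) = 0]. *)
Lemma pow_stirling2 (x : R) (p : nat) :
  x ^ p = sum_n (fun j => INR (stirling2 p j) * falling x j) p.
Proof.
  induction p as [|p IH].
  - rewrite sum_O. simpl. ring.
  - assert (Hsum : forall N,
      sum_n (fun j => INR (stirling2 (S p) j) * falling x j) N
      = x * sum_n (fun j => INR (stirling2 p j) * falling x j) N
        - INR (stirling2 p N) * falling x (S N) :> R).
    { induction N as [|N IHN].
      - rewrite !sum_O. simpl. ring.
      - rewrite !sum_Sn, IHN. change plus with Rplus.
        change (stirling2 (S p) (S N)) with (S N * stirling2 p (S N) + stirling2 p N)%nat.
        rewrite plus_INR, mult_INR. cbn [falling]. ring. }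
    rewrite Hsum, sum_Sn, (stirling2_gt p (S p)) by lia. change plus with Rplus.
    rewrite <- IH. simpl. ring.
Qed.

Lemma falling_INR_lt (n j : nat) : (n < j)%nat -> falling (INR n) j = 0.
Proof.
  intros H. induction j as [|j IH]; [ lia | ]. simpl.
  destruct (Nat.eq_dec n j) as [->|Hn]; [ ring | ].
  rewrite IH by lia. ring.
Qed.

Lemma falling_INR_fact (m j : nat) :
  falling (INR (j + m)) j * INR (fact m) = INR (fact (j + m)).
Proof.
  revert m. induction j as [|j IH]; intros m; [ apply Rmult_1_l | ].
  replace (S j + m)%nat with (j + S m)%nat by lia.
  rewrite <- IH, fact_simpl, mult_INR. cbn [falling].
  replace (INR (j + S m) - INR j) with (INR (S m)) by (rewrite plus_INR; ring).
  ring.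
Qed.

(** Both sides are [(j + m + r)! / (r! m!)]. *)
Lemma binomial_falling (r j m : nat) :
  Binomial.C (j + m + r) (j + m) * falling (INR (j + m)) j
  = INR (fact (r + j)) / INR (fact r) * Binomial.C (m + (r + j)) m.
Proof.
  unfold Binomial.C.
  replace (j + m + r - (j + m))%nat with r by lia.
  replace (m + (r + j) - m)%nat with (r + j)%nat by lia.
  replace (m + (r + j))%nat with (j + m + r)%nat by lia.
  rewrite <- (falling_INR_fact m j).
  pose proof (INR_fact_pos r). pose proof (INR_fact_pos m).
  pose proof (INR_fact_pos (r + j)). pose proof (INR_fact_pos (j + m)) as H2.
  rewrite <- (falling_INR_fact m j) in H2.
  field. nra.
Qed.

(** The weight [falling n j] kills the first [j] terms and turns the others into
    those of the negative binomial series of exponent [r + j + 1]; this is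
    [y^j] times the [j]-th derivative of [(1 - y)^(-(r + 1))], obtained without
    differentiating. *)
Lemma is_series_binomial_falling_pow (r j : nat) (y : C) :
  Cmod y < 1 ->
  is_series
    (fun n => RtoC (Binomial.C (n + r) n) * RtoC (falling (INR n) j) * y ^ n)%C
    (RtoC (INR (fact (r + j)) / INR (fact r)) * (y ^ j * / (1 - y) ^ S (r + j)))%C.
Proof.
  intros Hy. apply is_series_leading_zeros with j.
  - intros n Hn. rewrite falling_INR_lt by exact Hn.
    change zero with (RtoC 0).
    (* The equation is stated over the carrier of a normed module; [ring] has to
       see it over C *)
    refine (_ : @eq C _ _). ring.
  - rewrite Cmult_assoc.
    apply is_series_ext with
      (2 := is_series_scal (RtoC (INR (fact (r + j)) / INR (fact r)) * y ^ j)%C _ _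
              (is_series_binomial_pow (r + j) y Hy)).
    intros m. change scal with Cmult.
    rewrite <- RtoC_mult, binomial_falling, RtoC_mult, Cpow_add_r.
    refine (_ : @eq C _ _). ring.
Qed.

Lemma is_series_binomial_npow_pow (r p : nat) (y : C) :
  Cmod y < 1 ->
  is_series
    (fun n => RtoC (Binomial.C (n + r) n) * RtoC (INR n) ^ p * y ^ n)%C
    (sum_n (fun j => RtoC (INR (stirling2 p j))
              * (RtoC (INR (fact (r + j)) / INR (fact r))
                 * (y ^ j * / (1 - y) ^ S (r + j))))%C p).
Proof.
  intros Hy.
  assert (H := is_series_sum_n _ _ p (fun j _ =>
    is_series_scal (RtoC (INR (stirling2 p j))) _ _
      (is_series_binomial_falling_pow r j y Hy))).
  apply is_series_ext with (2 := H). clear H. intros n. cbv beta.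
  rewrite <- RtoC_pow, pow_stirling2.
  set (c := (RtoC (Binomial.C (n + r) n))).
  generalize p at 2 4. intros N. induction N as [|N IH].
  - rewrite !sum_O, RtoC_mult. change scal with Cmult. refine (_ : @eq C _ _). ring.
  - rewrite !sum_Sn, IH. change scal with Cmult. change plus with Cplus at 1.
    change plus with Rplus. rewrite RtoC_plus, RtoC_mult. refine (_ : @eq C _ _). ring.
Qed.

(** Taking real parts turns the complex series at a real point into this one. *)
Lemma ex_series_binomial_npow_Rpow (r p : nat) (rho : R) :
  0 <= rho < 1 ->
  ex_series (fun n => Binomial.C (n + r) n * INR n ^ p * rho ^ n).
Proof.
  intros Hrho.
  assert (Hc : Cmod (RtoC rho) < 1) by (rewrite Cmod_R, Rabs_pos_eq; lra).
  eexists.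
  apply is_series_ext with
    (2 := is_series_Re _ _ (is_series_binomial_npow_pow r p (RtoC rho) Hc)).
  intros n. now rewrite <- !RtoC_pow, <- !RtoC_mult.
Qed.

(** * The double series *)

(** Pascal's rule, with the boundary term of the partial sums made explicit as in
    [pow_stirling2]: up to [N = n] it stays within the range where that rule
    holds. *)
Lemma Cpow_one_plus (z : C) (n : nat) :
  ((1 + z) ^ n)%C = sum_n (fun m => RtoC (Binomial.C n m) * z ^ m)%C n.
Proof.
  induction n as [|n IH].
  - rewrite sum_O, C_n_0. simpl. ring.
  - assert (Hsum : forall N, (N <= n)%nat ->
      sum_n (fun m => RtoC (Binomial.C (S n) m) * z ^ m)%C N
      = ((1 + z) * sum_n (fun m => RtoC (Binomial.C n m) * z ^ m) N
         - RtoC (Binomial.C n N) * z ^ S N)%C :> C).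
    { induction N as [|N IHN]; intros HN.
      - rewrite !sum_O, !C_n_0. simpl. ring.
      - rewrite !sum_Sn, IHN, <- pascal, RtoC_plus, !Cpow_S by lia.
        change plus with Cplus. ring. }
    rewrite sum_Sn, Hsum, <- IH, !C_n_n, !Cpow_S by lia. change plus with Cplus. ring.
Qed.

Lemma RtoC_neq_0 (x : R) : x <> 0 -> RtoC x <> 0%C.
Proof. intros Hx E. apply Hx. now apply RtoC_inj. Qed.

(** With [w = k - x], the left-hand side is [x^j * k^r / w^(r + j + 1)], and
    [k / w = 1 + x / w]; the binomial theorem for [(1 + x / w)^r] then gives the
    right-hand side. *)
Lemma partial_fractions (k : R) (x : C) (r j : nat) :
  k <> 0 -> (RtoC k - x)%C <> 0%C ->
  (/ RtoC k * ((x / RtoC k) ^ j * / (1 - x / RtoC k) ^ S (r + j)))%C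
  = (sum_n (fun m => RtoC (Binomial.C r m) * x ^ m * / (RtoC k - x) ^ (m + j + 1)) r
     * x ^ j)%C.
Proof.
  intros Hk Hw. assert (Hk' := RtoC_neq_0 k Hk).
  assert (Hj := Cpow_nz _ j Hw). assert (Hr := Cpow_nz _ r Hw).
  assert (Hkj := Cpow_nz _ j Hk'). assert (Hkr := Cpow_nz _ r Hk').
  set (w := (RtoC k - x)%C) in *.
  transitivity ((1 + x / w) ^ r * (/ w ^ S j * x ^ j))%C.
  - replace (1 - x / RtoC k)%C with (w * / RtoC k)%C by (unfold w; field; exact Hk').
    replace (1 + x / w)%C with (RtoC k * / w)%C by (unfold w; field; exact Hw).
    unfold Cdiv. rewrite !Cpow_S, !Cpow_add_r, !Cpow_mult_l, !Cpow_inv by assumption.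
    field. repeat split; assumption.
  - rewrite Cpow_one_plus, Cmult_assoc. f_equal.
    rewrite <- (sum_n_mult_r (K := C_Ring)). apply sum_n_ext. intros m.
    assert (Hm := Cpow_nz _ m Hw).
    change mult with Cmult. unfold Cdiv.
    rewrite Cpow_mult_l, Cpow_inv, Cpow_S, !Cpow_add_r, Cpow_1_r by assumption.
    refine (_ : @eq C _ _). field. repeat split; assumption.
Qed.

(** The hypothesis [0 < j] makes all exponents [m + j + 1] at least [2], where the
    Hurwitz series converge; their bases are [k + (2 - x)]. *)
Lemma is_series_hurwitz_A (r j : nat) (x : C) :
  (0 < j)%nat -> Cmod x < 2 ->
  is_series
    (fun k => sum_n (fun m => RtoC (Binomial.C r m) * x ^ m
                     * / (RtoC (INR (k + 2)) - x) ^ (m + j + 1))%C r)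
    (A r x j).
Proof.
  intros Hj Hx.
  refine (is_series_sum_n
            (fun m k => RtoC (Binomial.C r m) * x ^ m
               * / (RtoC (INR (k + 2)) - x) ^ (m + j + 1))%C _ r (fun m _ => _)).
  assert (Hre : 0 < Re (2 - x)%C).
  { pose proof (re_le_Cmod x) as H. apply Rabs_le_between in H.
    destruct x as [x1 x2]. simpl in *. lra. }
  apply is_series_ext with
    (2 := is_series_scal (RtoC (Binomial.C r m) * x ^ m)%C _ _
            (is_series_hurwitz_zeta (m + j + 1) (2 - x) ltac:(lia) Hre)).
  intros k. change scal with Cmult. do 3 f_equal.
  rewrite plus_INR, RtoC_plus. replace (INR 2) with 2 by (simpl; lra).
  refine (_ : @eq C _ _). ring.
Qed.

(** Two of the [n + 2] factors [/ kappa] are kept, for the convergence of the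
    sum over [kappa]. The other [n] are at most [/ 2], one short of the [n + 1]
    halves in [(Cmod x / 2) ^ S n]; hence the constant [2]. *)
Lemma double_series_bound (n : nat) (x : C) (kappa : R) :
  2 <= kappa ->
  Cmod (x ^ S n * / RtoC kappa ^ (n + 2))%C
  <= (Cmod x / 2) ^ S n * (2 * / kappa ^ 2).
Proof.
  intros Hk.
  assert (Hk0 : RtoC kappa <> 0%C) by (apply RtoC_neq_0; lra).
  rewrite Cmod_mult, Cmod_inv, !Cmod_pow, Cmod_R, Rabs_pos_eq
    by (lra || now apply Cpow_nz).
  replace (Cmod x) with (Cmod x / 2 * 2) at 1 by field.
  rewrite Rpow_mult_distr, Rmult_assoc.
  pose proof (Cmod_ge_0 x).
  apply Rmult_le_compat_l; [ apply pow_le; lra | ].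
  assert (Hkn : 0 < kappa ^ n) by (apply pow_lt; lra).
  assert (Hpow : 2 ^ n <= kappa ^ n) by (apply pow_incr; lra).
  replace (2 ^ S n * / kappa ^ (n + 2))
    with (2 * / kappa ^ 2 * (2 ^ n / kappa ^ n))
    by (rewrite pow_add; simpl; field; lra).
  rewrite <- (Rmult_1_r (2 * / kappa ^ 2)) at 2.
  apply Rmult_le_compat_l.
  - apply Rmult_le_pos; [ lra | ]. apply Rlt_le, Rinv_0_lt_compat, pow_lt. lra.
  - apply Rle_div_l; lra.
Qed.

(** The inner sum of the double series, over [n] for [kappa = k + 2]: the series of
    [is_series_binomial_npow_pow] at [x / kappa], divided by [kappa] and freed of
    its term at [n = 0], which is zero as [p > 0]. *)
Lemma is_series_column (r p : nat) (x : C) (kappa : R) :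
  (0 < p)%nat -> Cmod x < kappa ->
  is_series
    (fun n => RtoC (Binomial.C (S n + r) (S n)) * RtoC (INR (S n)) ^ p
              * (x ^ S n * / RtoC kappa ^ (n + 2)))%C
    (sum_n (fun j => RtoC (INR (stirling2 p j) * (INR (fact (r + j)) / INR (fact r)))
              * x ^ j
              * sum_n (fun m => RtoC (Binomial.C r m) * x ^ m
                                * / (RtoC kappa - x) ^ (m + j + 1)) r)%C p).
Proof.
  intros Hp Hx.
  assert (Hk : 0 < kappa) by (pose proof (Cmod_ge_0 x); lra).
  assert (Hk0 : RtoC kappa <> 0%C) by (apply RtoC_neq_0; lra).
  assert (Hkx : (RtoC kappa - x)%C <> 0%C).
  { apply Cminus_eq_contra. intros E.
    rewrite <- E, Cmod_R, Rabs_pos_eq in Hx; lra. }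
  assert (Hy : Cmod (x / RtoC kappa) < 1).
  { rewrite Cmod_div, Cmod_R, Rabs_pos_eq by (exact Hk0 || lra).
    apply Rlt_div_l; lra. }
  assert (Hn : (RtoC (INR 0) ^ p)%C = 0%C).
  { destruct p as [|p]; [ lia | ]. simpl. apply Cmult_0_l. }
  assert (H := is_series_scal (/ RtoC kappa)%C _ _
                 (is_series_binomial_npow_pow r p _ Hy)).
  apply is_series_incr_1_zero in H;
    [ | rewrite Hn, Cmult_0_r, Cmult_0_l; apply Cmult_0_r ].
  match type of H with is_series _ ?l => match goal with |- is_series _ ?l' =>
    replace l' with l; [ apply is_series_ext with (2 := H) | ] end end.
  - intros n. change scal with Cmult. unfold Cdiv.
    rewrite Cpow_mult_l, Cpow_inv by exact Hk0.
    assert (H0 := Cpow_nz _ n Hk0).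
    replace (n + 2)%nat with (S (S n)) by lia. rewrite (Cpow_S (RtoC kappa)).
    refine (_ : @eq C _ _). rewrite !(Cpow_S (RtoC kappa)). field. now split.
  - etransitivity; [ symmetry; apply (sum_n_mult_l (K := C_Ring)) | ].
    apply sum_n_ext. intros j. change mult with Cmult.
    rewrite RtoC_mult, <- Cmult_assoc, (Cmult_comm (x ^ j)).
    rewrite <- partial_fractions by (assumption || lra).
    refine (_ : @eq C _ _). ring.
Qed.

(* The series starts at n = 1: its k-th term (k >= 0) is the one for n = k + 1. *)
Theorem proposition21 :
  forall (r p : nat) (x : C),
    (0 < p)%nat ->
    (Cmod x < 2)%R ->
    is_series
      (fun k : nat =>
         let n := S k in
         (RtoC (Binomial.C (n + r) n) * RtoC (INR n) ^ p
          * (riemann_zeta (RtoC (INR (n + 1))) - 1) * x ^ n)%C)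
      (1 / RtoC (INR (fact r))
       * sum_n (fun j : nat =>
                  (RtoC (INR (stirling2 p j)) * RtoC (INR (fact (r + j)))
                   * A r x j * x ^ j)%C) p)%C.
Proof.
  intros r p x Hp Hx. cbv zeta.
  assert (Hk : forall k, 2 <= INR (k + 2)).
  { intros k. change 2 with (INR 2). apply le_INR. lia. }
  set (w := fun n => Binomial.C (n + r) n * INR n ^ p).
  assert (Hw : forall n, (RtoC (Binomial.C (n + r) n) * RtoC (INR n) ^ p)%C = RtoC (w n)).
  { intros n. unfold w. now rewrite RtoC_mult, RtoC_pow. }
  assert (Hw0 : forall n, 0 <= w n).
  { intros n. apply Rmult_le_pos; [ apply Rlt_le, binomial_pos | apply pow_le, pos_INR ]. }
  refine (is_series_interchange
    (fun n k => RtoC (w (S n)) * (x ^ S n * / RtoC (INR (k + 2)) ^ (n + 2)))%C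
    (fun n => w (S n) * (Cmod x / 2) ^ S n) (fun k => 2 * / INR (S k) ^ 2)
    _ _ _ _ _ _ _ (fun k => is_series_ext _ _ _ _
                       (is_series_column r p x (INR (k + 2)) Hp _)) _).
  - intros n k. change (norm ?z) with (Cmod z).
    rewrite Cmod_mult, Cmod_R, Rabs_pos_eq, Rmult_assoc by apply Hw0.
    apply Rmult_le_compat_l; [ apply Hw0 | ].
    eapply Rle_trans; [ now apply double_series_bound | ].
    apply Rmult_le_compat_l.
    + apply pow_le. pose proof (Cmod_ge_0 x). lra.
    + apply Rmult_le_compat_l; [ lra | ].
      assert (HS : 0 < INR (S k)) by (apply lt_0_INR; lia).
      apply Rinv_le_contravar; [ now apply pow_lt | ].
      apply pow_incr. split; [ lra | ]. apply le_INR. lia.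
  - apply (ex_series_incr_1 (fun n => w n * (Cmod x / 2) ^ n)).
    apply ex_series_binomial_npow_Rpow. pose proof (Cmod_ge_0 x). lra.
  - exact (ex_series_scal_l 2 _ ex_series_inv_sqr).
  - intros n. rewrite Hw. replace (S n + 1)%nat with (n + 2)%nat by lia.
    replace (RtoC (w (S n)) * _ * x ^ S n)%C
      with (RtoC (w (S n)) * x ^ S n * (riemann_zeta (RtoC (INR (n + 2))) - 1))%C by ring.
    apply is_series_ext with
      (2 := is_series_scal (RtoC (w (S n)) * x ^ S n)%C _ _
              (is_series_riemann_zeta_minus_1 n)).
    intros k. change scal with Cmult. symmetry. apply Cmult_assoc.
  - intros n. now rewrite <- Hw.
  - specialize (Hk k). lra.
  - rewrite <- (sum_n_mult_l (K := C_Ring)). change mult with Cmult.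
    refine (is_series_sum_n
      (fun j k => RtoC (INR (stirling2 p j) * (INR (fact (r + j)) / INR (fact r)))
              * x ^ j
              * sum_n (fun m => RtoC (Binomial.C r m) * x ^ m
                                * / (RtoC (INR (k + 2)) - x) ^ (m + j + 1)) r)%C
      _ p (fun j _ => _)).
    destruct j as [|j].
    + (* The inner sums do not form a convergent series for [j = 0]: the zero
         coefficient has to be used before summing over [k] *)
      assert (E : stirling2 p 0 = 0%nat) by (destruct p; [ lia | reflexivity ]).
      rewrite E. change (INR 0) with 0. rewrite !Cmult_0_l, Cmult_0_r.
      apply is_series_ext with (2 := is_series_zero (V := C_NormedModule)).
      intros k. now rewrite Rmult_0_l, !Cmult_0_l.
    + assert (Hr := RtoC_neq_0 _ (INR_fact_neq_0 r)).
      replace (1 / RtoC (INR (fact r)) * _)%C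
        with (RtoC (INR (stirling2 p (S j)) * (INR (fact (r + S j)) / INR (fact r)))
              * x ^ S j * A r x (S j))%C
        by (rewrite RtoC_mult, RtoC_div by apply INR_fact_neq_0; field; exact Hr).
      exact (is_series_scal _ _ _ (is_series_hurwitz_A r (S j) x (Nat.lt_0_succ j) Hx)).
Qed.
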